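(* Let $X$ be a Tychonoff space and $\mathbb{V}(X)$ the free topological vector space over $X$. Then: (i) $\mathbb{V}(X)$ is barrelled if and only if $X$ is discrete. (ii) Let $X$ be discrete. Then $\mathbb{V}(X)$ is a Baire-like space if and only if $X$ is finite. (iii) Let $X$ be discrete. Then $\mathbb{V}(X)$ is a Baire space if and only if $X$ is finite.
   Context: All vector spaces are over $\mathbb{R}$; all topological spaces are Tychonoff (so topological vector spaces are Hausdorff). The free topological vector space over a Tychonoff space $X$ is a topological vector space $\mathbb{V}(X)$ together with a continuous map $i:X\to\mathbb{V}(X)$ such that for every continuous map $f$ from $X$ to a topological vector space $E$ there is a unique continuous linear operator $\bar f:\mathbb{V}(X)\to E$ with $f=\bar f\circ i$. A barrel in a topological vector space is a closed, absolutely convex, absorbing subset. A topological vector space $E$ (not necessarily locally convex) is barrelled if every barrel in $E$ is a neighborhood of zero. $E$ is Baire-like if every increasing sequence $\{A_n\}_{n\in\mathbb{N}}$ of absolutely convex closed subsets covering $E$ contains a member which is a neighborhood of zero. *)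

(* Defs.v *)
From mathcomp Require Import all_boot all_order all_algebra.
From mathcomp Require Import all_classical all_reals all_analysis.

Set Implicit Arguments.
Unset Strict Implicit.
Unset Printing Implicit Defensive.

Import GRing.Theory Num.Theory.
Import numFieldNormedType.Exports.

Local Open Scope classical_set_scope.
Local Open Scope ring_scope.

Definition tychonoff_space (X : topologicalType) : Prop :=
  completely_regular_space X /\ hausdorff_space X.

Definition discrete_space (X : topologicalType) : Prop :=
  forall A : set X, open A.

Definition baire_space (X : topologicalType) : Prop :=
  forall U : (set X)^nat,
    (forall n, open (U n) /\ dense (U n)) -> dense (\bigcap_n U n).

(* The test spaces are [topologicalLmodType]s, not [tvsType]s, because the
   latter are locally convex.  Neither structure includes the Hausdorff axiom;
   a Hausdorff topological vector space is automatically Tychonoff. *)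
Definition is_free_tvs (R : realType) (X : topologicalType)
    (V : topologicalLmodType R) (i : X -> V) : Prop :=
  [/\ hausdorff_space V,
      continuous i &
      forall (E : topologicalLmodType R) (f : X -> E),
        hausdorff_space E -> continuous f ->
        exists! g : V -> E, [/\ linear g, continuous g & f = g \o i]].

Section barrels.
Context (R : realType) (E : topologicalLmodType R).

Definition balanced (A : set E) : Prop :=
  forall (a : R) (x : E), `|a| <= 1 -> A x -> A (a *: x).

Definition absolutely_convex (A : set E) : Prop :=
  convex_set A /\ balanced A.

Definition absorbing (A : set E) : Prop :=
  forall x : E, exists2 r : R, 0 < r & forall a : R, `|a| <= r -> A (a *: x).

Definition barrel (A : set E) : Prop :=
  [/\ closed A, absolutely_convex A & absorbing A].

End barrels.

Definition barrelled (R : realType) (E : topologicalLmodType R) : Prop :=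
  forall A : set E, barrel A -> nbhs (0 : E) A.

Definition baire_like (R : realType) (E : topologicalLmodType R) : Prop :=
  forall A : (set E)^nat,
    {homo A : m n / (m <= n)%N >-> m `<=` n} ->
    (forall n, absolutely_convex (A n) /\ closed (A n)) ->
    \bigcup_n A n = setT ->
    exists n, nbhs (0 : E) (A n).

(* Main.v *)
Require Import Defs.
From HB Require Import structures.
From mathcomp Require Import all_boot all_order all_algebra.
From mathcomp Require Import all_classical all_reals all_analysis.
From mathcomp Require Import ring lra.

Set Implicit Arguments.
Unset Strict Implicit.
Unset Printing Implicit Defensive.

Import Order.TTheory GRing.Theory Num.Theory.
Import numFieldNormedType.Exports.

Local Open Scope classical_set_scope.
Local Open Scope ring_scope.

(** The whole proof rests on one consequence of the universal property.  Let A
be a disk of V, that is, a nonempty absolutely convex set.  The vectors absorbed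
by A form a linear subspace W, and W becomes a Hausdorff topological vector
space when its topology is generated by the subspace topology of V together with
the gauge of A.  If A absorbs every i x, and if i is continuous for the gauge of
A, then i is a continuous map into W and extends to a continuous linear map
g : V -> W.  The inclusion of W in V composed with g agrees with the identity on
i(X), hence is the identity.  So W = V, the topology of V is finer than
the gauge topology, and A is a neighborhood of 0 ([free_tvs_disk_nbhs0]).

Taking for A a subspace that contains i(X), the conditions hold trivially, and
a subspace that is a neighborhood of 0 is everything: i(X) spans V
([free_tvs_submod]).  It follows that a disk absorbing i(X) absorbs V.

If X is discrete, the map i into W is always continuous, so every barrel is a
neighborhood of 0.  Conversely, the set of the vectors v with |g v| <= 1 for all
continuous linear forms g bounded by 1 on i(X) is a barrel.  If it is a
neighborhood of 0, then a point y close to x satisfies |h y - h x| <= 1 for all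
continuous h : X -> [-1, 1]; complete regularity provides an h with h y = -1 and
h x = 1 as soon as y differs from x, so x is isolated.

If X is discrete and infinite, the coordinates along a sequence of distinct
points are continuous linear forms, and the subspaces on which all but the first
n of them vanish are closed, proper, increasing, and cover V
([free_tvs_infinite_exhaustion]).  A proper subspace has empty interior, so V is
neither Baire-like nor Baire.  If X is finite and the A_n are as in the
definition of a Baire-like space, some A_n contains 0 and i(X), so it is a disk
absorbing i(X).  Finally, for finite X, the space V is an
open continuous linear image of R^n, where Baire's theorem holds. *)

(** * Linear maps and limits in topological vector spaces *)

Section linear_maps.
Context {R : realType} {E F : lmodType R} {g : E -> F}.
Hypothesis lg : linear g.

Lemma linear_map0 : g 0 = 0.
Proof. by have := lg (-1) 0 0; rewrite scaler0 addr0 scaleN1r addNr. Qed.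

Lemma linear_mapZ a v : g (a *: v) = a *: g v.
Proof. by have := lg a v 0; rewrite !addr0 linear_map0 addr0. Qed.

Lemma linear_mapD v w : g (v + w) = g v + g w.
Proof. by have := lg 1 v w; rewrite !scale1r. Qed.

End linear_maps.

Section tvs_limits.
Context {R : realType} {E : topologicalLmodType R} {T : Type}.
Context {F : set_system T} {FF : Filter F}.
Implicit Types (f g : T -> E) (v w : E).

Lemma tvs_cvgD f g v w : f @ F --> v -> g @ F --> w ->
  (fun t => f t + g t) @ F --> v + w.
Proof.
move=> fv gw; apply: (@cvg_comp _ _ _ (fun t => (f t, g t))
  (fun x : E * E => x.1 + x.2) F (nbhs (v, w)) (nbhs (v + w))).
  exact: cvg_pair.
exact: (@add_continuous E (v, w)).
Qed.

Lemma tvs_cvgZ (k : T -> R^o) f (a : R^o) v : k @ F --> a -> f @ F --> v ->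
  (fun t => (k t : R) *: f t) @ F --> (a : R) *: v.
Proof.
move=> ka fv; apply: (@cvg_comp _ _ _ (fun t => (k t, f t))
  (fun x : R^o * E => (x.1 : R) *: x.2) F (nbhs (a, v)) (nbhs ((a : R) *: v))).
  exact: (cvg_pair ka fv).
exact: (@scale_continuous R E (a, v)).
Qed.

End tvs_limits.

(** * Disks *)

Section disks.
Context {R : realType} {E : lmodType R}.
Implicit Types (A : set E) (v w : E).

(** Absolute convexity stated with two coefficients: this form needs no
topology, and excludes the empty set. *)
Definition disk A := A 0 /\
  forall (a b : R) v w, `|a| + `|b| <= 1 -> A v -> A w -> A (a *: v + b *: w).

(** Membership is boolean so that the algebraic theory of closed predicates
applies to this set, which is the span of A when A is a disk. *)
Definition absorbed A : {pred E} :=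
  fun v => `[< exists2 r : R, 0 < r & A (r *: v) >].

Lemma diskZ A (a : R) v : disk A -> `|a| <= 1 -> A v -> A (a *: v).
Proof.
move=> [_ dA] a1 Av; have := dA a 0 v v.
by rewrite normr0 addr0 scale0r addr0; apply.
Qed.

Lemma disk_absorbed A v : disk A -> v \in absorbed A ->
  exists2 r : R, 0 < r & forall a : R, `|a| <= r -> A (a *: v).
Proof.
move=> dA /asboolP[r r0 Av]; exists r => // a ar.
rewrite -(divfK (lt0r_neq0 r0) a) -scalerA; apply: diskZ => //.
by rewrite normrM normfV (gtr0_norm r0) ler_pdivrMr// mul1r.
Qed.

Lemma absorbed_submod A : disk A -> GRing.submod_closed (absorbed A).
Proof.
move=> dA; split.
  by apply/asboolP; exists 1 => //; rewrite scaler0; case: dA.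
move=> a v w Av Aw; apply/asboolP.
have [r r0 Arv] := disk_absorbed dA Av.
have [s s0 Asw] := disk_absorbed dA Aw.
(* t is such that |2 t a| <= r and 2 t <= s *)
have a0 : 0 < 1 + `|a| by rewrite ltr_pwDl.
pose t := Num.min (r / (1 + `|a|)) s / 2.
have m0 : 0 < Num.min (r / (1 + `|a|)) s by rewrite lt_min divr_gt0.
have t0 : 0 < t by rewrite divr_gt0.
exists t => //.
have -> : t *: (a *: v + w)
    = 2^-1 *: ((2 * t * a) *: v) + 2^-1 *: ((2 * t) *: w).
  by rewrite scalerDr !scalerA !mulrA mulVf ?mul1r.
have t2 : 2 * t = Num.min (r / (1 + `|a|)) s by rewrite /t mulrC divfK.
rewrite t2; apply: dA.2; first by rewrite gtr0_norm//; lra.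
  apply: Arv; rewrite normrM (gtr0_norm m0).
  have : Num.min (r / (1 + `|a|)) s <= r / (1 + `|a|) by rewrite ge_min lexx.
  rewrite ler_pdivlMr//; apply: le_trans.
  by rewrite ler_wpM2l ?(ltW m0)// lerDr.
by apply: Asw; rewrite gtr0_norm// ge_min lexx orbT.
Qed.

(** A condition [A (e *: v)] plays the role of a bound of the gauge of A at v by
1 / e, so that larger e means closer to 0. *)
Lemma disk_weaken A (e e' : R) v :
  disk A -> 0 <= e <= e' -> A (e' *: v) -> A (e *: v).
Proof.
move=> dA /andP[e0 ee'] Av.
have [e'0|e'0] := eqVneq e' 0.
  have -> : e = 0 by apply/eqP; rewrite eq_le e0 andbT -e'0.
  by rewrite scale0r; case: dA.
rewrite -(divfK e'0 e) -scalerA; apply: diskZ => //.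
have e'p : 0 < e' by rewrite lt_def e'0 (le_trans e0).
by rewrite ger0_norm ?divr_ge0 ?(ltW e'p)// ler_pdivrMr// mul1r.
Qed.

(** The triangle inequality for the gauge of A, with two equal bounds. *)
Lemma disk_midpoint A (e : R) v w :
  disk A -> A ((2 * e) *: v) -> A ((2 * e) *: w) -> A (e *: (v + w)).
Proof.
move=> dA Av Aw.
have -> : e *: (v + w) = 2^-1 *: ((2 * e) *: v) + 2^-1 *: ((2 * e) *: w).
  by rewrite !scalerA !mulrA mulVf// mul1r scalerDr.
by apply: dA.2 => //; rewrite gtr0_norm//; lra.
Qed.

Lemma submod_disk (S : {pred E}) :
  GRing.submod_closed S -> disk [set v | v \in S].
Proof.
move=> [S0 SD]; split => // a b v w _ /= Sv Sw; apply: (SD) => //.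
by rewrite -[_ *: _]addr0 SD.
Qed.

End disks.

(** * The span of a disk as a topological vector space *)

Section disk_span.
Context {R : realType} {V : topologicalLmodType R} {A : set V}.

(** The proof that A is a disk is a parameter of the type because the vector
space structure depends on it. *)
Record disk_span (dA : disk A) := DiskSpan {
  span_val : V;
  span_valP : span_val \in absorbed A }.

Arguments span_val {dA}.

Variable dA : disk A.
Local Notation W := (disk_span dA).

HB.instance Definition _ := [isSub of W for span_val].
HB.instance Definition _ := [Choice of W by <:].
HB.instance Definition _ :=
  GRing.SubChoice_isSubLmodule.Build R V (absorbed A) W
    (GRing.submod_closed_semi (absorbed_submod dA)).

(** The neighborhoods of w in the coarsest vector topology for which both the
inclusion in V and the gauge of A are continuous. *)
Definition disk_span_nbhs (w : W) : set_system W :=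
  filter_from [set Ue : set V * R | nbhs (span_val w) Ue.1 /\ 0 < Ue.2]
    (fun Ue => [set y | Ue.1 (span_val y) /\
                        A (Ue.2 *: (span_val y - span_val w))]).

HB.instance Definition _ := hasNbhs.Build W disk_span_nbhs.

Lemma disk_span_filter (w : W) : ProperFilter (nbhs w).
Proof.
apply: filter_from_proper; last first.
  move=> [U e] [/= Uw e0]; exists w; split; first exact: nbhs_singleton.
  by rewrite subrr scaler0; case: dA.
apply: filter_from_filter.
  by exists (setT, 1); split => //=; exact: filterT.
move=> [U e] [U' e'] [/= Uw e0] [/= Uw' e0'].
exists (U `&` U', e + e') => /=.
  by split; [exact: filterI|exact: addr_gt0].
move=> y [/= [Uy Uy'] Ay].
by split; split => //=; apply: disk_weaken Ay => //; lra.
Qed.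

Lemma disk_span_nbhs_singleton (w : W) (S : set W) :
  nbhs w S -> S w.
Proof.
move=> [[U e] [/= Uw e0]]; apply; split => /=; first exact: nbhs_singleton.
by rewrite subrr scaler0; case: dA.
Qed.

Lemma disk_span_nbhs_nbhs (w : W) (S : set W) :
  nbhs w S -> nbhs w (nbhs^~ S).
Proof.
move=> [[U e] [/= Uw e0] US]; exists (U^°, 2 * e) => /=.
  by split; [exact: nbhs_interior|lra].
move=> y [/= Uy Ay]; exists (U, 2 * e) => /=; first by split => //; lra.
move=> z [/= Uz Az]; apply: US; split => //=.
rewrite -(subrKA (span_val y)); exact: disk_midpoint.
Qed.

HB.instance Definition _ := Nbhs_isNbhsTopological.Build W
  disk_span_filter disk_span_nbhs_singleton disk_span_nbhs_nbhs.

Lemma span_val_continuous : continuous span_val.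
Proof.
move=> w U Uw; exists (U, 1) => /=; first by split.
by move=> y [].
Qed.

Lemma near_disk_span (w : W) (e : R) : 0 < e ->
  \forall y \near w, A (e *: (span_val y - span_val w)).
Proof.
move=> e0; exists (setT, e) => /=; first by split => //; exact: filterT.
by move=> y [].
Qed.

Lemma cvg_disk_span (T : Type) (F : set_system T) (f : T -> W)
    (w : W) : Filter F ->
  span_val \o f @ F --> span_val w ->
  (forall e : R, 0 < e ->
    \forall t \near F, A (e *: (span_val (f t) - span_val w))) ->
  f @ F --> w.
Proof.
move=> FF fw Af S [[U e] [/= Uw e0] US].
near=> t; apply: US; split => /=; last by near: t; exact: Af.
by near: t; exact: fw.
Unshelve. all: by end_near. Qed.

Lemma disk_span_add_continuous :
  continuous (fun x : W * W => x.1 + x.2).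
Proof.
move=> [v w]; apply: (cvg_disk_span (F := nbhs (v, w))) => [|e e0].
  apply: (tvs_cvgD (f := fun x => span_val x.1) (g := fun x => span_val x.2)).
    by apply: cvg_comp; [exact: cvg_fst|exact: span_val_continuous].
  by apply: cvg_comp; [exact: cvg_snd|exact: span_val_continuous].
have e2 : 0 < 2 * e by rewrite mulr_gt0.
have Av : \forall x \near (v, w), A (2 * e *: (span_val x.1 - span_val v)).
  exact: (cvg_fst (G := nbhs w) (near_disk_span v e2)).
have Aw : \forall x \near (v, w), A (2 * e *: (span_val x.2 - span_val w)).
  exact: (cvg_snd (F := nbhs v) (near_disk_span w e2)).
apply: filterS (filterI Av Aw) => x [/= {}Av {}Aw].
rewrite opprD addrACA; exact: disk_midpoint.
Qed.

HB.instance Definition _ :=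
  PreTopologicalNmodule_isTopologicalNmodule.Build W
    disk_span_add_continuous.

Lemma disk_span_scale_continuous :
  continuous (fun z : R^o * W => z.1 *: z.2).
Proof.
move=> [a w]; apply: (cvg_disk_span (F := nbhs (a : R^o, w))) => [|e e0].
  apply: (tvs_cvgZ (k := fst) (f := fun x => span_val x.2)).
    exact: cvg_fst.
  by apply: cvg_comp; [exact: cvg_snd|exact: span_val_continuous].
have [r r0 Ar] := disk_absorbed dA (valP w).
have e2 : 0 < 2 * e by rewrite mulr_gt0.
have M0 : 0 < 2 * e * (`|a| + 1) by rewrite mulr_gt0// ltr_wpDl.
have near_a (d : R) : 0 < d ->
    \forall x \near (a : R^o, w), `|x.1 - a| <= d.
  move=> d0; have ad : \forall b \near (a : R^o), `|b - a| <= d.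
    exact: (cvgr_distC_le id (a : R^o) cvg_id d d0).
  exact: (cvg_fst (G := nbhs w) ad).
have near_w : \forall x \near (a : R^o, w),
    A (2 * e * (`|a| + 1) *: (span_val x.2 - span_val w)).
  exact: (cvg_snd (F := nbhs (a : R^o)) (near_disk_span w M0)).
have near1 := near_a 1 ltr01.
have near_r := near_a (r / (2 * e)) (divr_gt0 r0 e2).
apply: filterS (filterI near1 (filterI near_r near_w)) => x [/= xa1 [xar Ax]].
have -> : x.1 *: span_val x.2 - a *: span_val w
    = x.1 *: (span_val x.2 - span_val w) + (x.1 - a) *: span_val w.
  by rewrite scalerBr scalerBl addrA subrK.
apply: disk_midpoint => //.
  rewrite scalerA -(divfK (lt0r_neq0 M0) (2 * e * x.1)) -scalerA.
  apply: diskZ => //.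
  rewrite normrM normfV (gtr0_norm M0) ler_pdivrMr// mul1r normrM.
  rewrite (gtr0_norm e2) ler_pM2l// -lerBlDl.
  exact: le_trans (lerB_dist _ _) _.
rewrite scalerA; apply: Ar.
by rewrite normrM (gtr0_norm e2) mulrC -ler_pdivlMr.
Qed.

HB.instance Definition _ :=
  TopologicalNmodule_isTopologicalLmodule.Build R W
    disk_span_scale_continuous.

Lemma disk_span_hausdorff : hausdorff_space V -> hausdorff_space W.
Proof.
move=> hV v w vw; apply: val_inj; apply: hV => B C Bv Cw.
have [z [Bz Cz]] := vw _ _ (span_val_continuous Bv) (span_val_continuous Cw).
by exists (span_val z).
Qed.

End disk_span.

Arguments span_val {R V A dA}.

(** * Disks and neighborhoods of zero *)

Section absolutely_convex_sets.
Context {R : realType} {E : topologicalLmodType R}.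
Implicit Types A : set E.

Lemma absolutely_convex_disk A : absolutely_convex A -> A 0 -> disk A.
Proof.
move=> [cA bA] A0; split => // a b v w ab Av Aw.
pose s := `|a| + `|b|.
have [s0|s_neq0] := eqVneq s 0.
  have /eqP := s0; rewrite paddr_eq0 ?normr_ge0// !normr_eq0.
  by move=> /andP[/eqP -> /eqP ->]; rewrite !scale0r addr0.
have s_gt0 : 0 < s by rewrite lt_def s_neq0 addr_ge0.
have as1 : `|a| / s <= 1 by rewrite ler_pdivrMr// mul1r lerDl.
have sgA (c : R) u : A u -> A ((Num.sg c * s) *: u).
  apply: bA; rewrite normrM normr_sg (gtr0_norm s_gt0).
  by case: (c != 0); rewrite ?mul1r ?mul0r.
(* a v + b w is the convex combination, with weights |a| / s and |b| / s, of
   s sg(a) v and s sg(b) w, which lie in A by balancedness. *)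
have := cA _ _ (Itv01 (divr_ge0 (normr_ge0 a) (ltW s_gt0)) as1)
  (mem_set (sgA a v Av)) (mem_set (sgA b w Aw)).
have onem_as : unstable.onem (`|a| / s) = `|b| / s.
  by rewrite /unstable.onem -[1](divff s_neq0) -mulrBl /s addrC addKr.
have sgK (c : R) : `|c| / s * (Num.sg c * s) = c.
  by rewrite mulrCA divfK// -numEsg.
by rewrite inE /conv/= !scalerA onem_as !sgK.
Qed.

Lemma disk_absolutely_convex A : disk A -> absolutely_convex A.
Proof.
move=> dA; split; last by move=> a v a1; exact: diskZ.
move=> v w k /set_mem Av /set_mem Aw; apply/mem_set; apply: dA.2 => //.
by rewrite ger0_norm// ger0_norm ?unstable.onem_ge0// unstable.add_onemK.
Qed.

Lemma nbhs0_absorbed A v : nbhs 0 A -> v \in absorbed A.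
Proof.
move=> A0; apply/asboolP.
have : \forall a \near (0 : R^o), A ((a : R) *: v).
  have := tvs_cvgZ (@cvg_id _ (nbhs (0 : R^o))) (cvg_cst v).
  by rewrite scale0r; apply.
move=> /nbhs_ballP[r /= r0 rA].
exists (r / 2); first by rewrite divr_gt0.
apply: rA.
rewrite /ball/= sub0r normrN gtr0_norm ?divr_gt0//; lra.
Qed.

Lemma nbhs0_submod (S : {pred E}) : GRing.submod_closed S ->
  nbhs 0 [set v | v \in S] -> forall v, v \in S.
Proof.
move=> [S0 SD] nS v; have /(nbhs0_absorbed v)/asboolP[r r0 /= Sv] := nS.
by rewrite -(scalerK (lt0r_neq0 r0) v) -[_ *: _]addr0 SD.
Qed.

End absolutely_convex_sets.

(** * Disks of a free topological vector space *)

Section free_tvs.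
Context {R : realType} {X : topologicalType} {V : topologicalLmodType R}.
Context {i : X -> V} (freeV : is_free_tvs i).

Lemma free_tvs_ext (E : topologicalLmodType R) (g h : V -> E) :
  hausdorff_space E -> linear g -> continuous g -> linear h -> continuous h ->
  g \o i = h \o i -> g = h.
Proof.
move=> hE lg cg lh ch gh; have [_ ci extend] := freeV.
have cgi : continuous (g \o i).
  by move=> x; apply: continuous_comp; [exact: ci|exact: cg].
have [k [_ k_unique]] := extend E (g \o i) hE cgi.
by rewrite -(k_unique g)// -(k_unique h).
Qed.

(** The universal property is applied to i seen as a map into the span of A;
the resulting map is a section of the inclusion of that span in V, which forces
the inclusion to be a homeomorphism. *)
Lemma free_tvs_disk_nbhs0 (A : set V) : disk A ->
  (forall x, i x \in absorbed A) ->
  (forall x (e : R), 0 < e -> \forall y \near x, A (e *: (i y - i x))) ->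
  nbhs 0 A.
Proof.
move=> dA iA iAcont; have [hV ci extend] := freeV.
pose f x : disk_span dA := DiskSpan dA (iA x).
have cf : continuous f.
  by move=> x; apply: cvg_disk_span; [exact: ci|exact: iAcont].
have [g [[lg cg fg] _]] := extend _ f (disk_span_hausdorff hV) cf.
have gK : span_val \o g = id.
  apply: free_tvs_ext => //.
  - by move=> a u v /=; rewrite lg.
  - by move=> v; apply: continuous_comp; [exact: cg|exact: span_val_continuous].
  - by move=> v; exact: cvg_id.
  - by apply/funext => x /=; rewrite -[g (i x)]/((g \o i) x) -fg.
have g0 : span_val (g 0) = 0 by rewrite -[LHS]/((span_val \o g) 0) gK.
have Ag : \forall v \near (0 : V), A (1 *: (span_val (g v) - span_val (g 0))).
  exact: (cg 0 _ (near_disk_span (g 0) ltr01)).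
apply: filterS Ag => v; rewrite scale1r g0 subr0.
by rewrite -[span_val (g v)]/((span_val \o g) v) gK.
Qed.

(** i(X) spans V, in the form of an induction principle: a subspace S is a disk
whose gauge is 0 on S, so the gauge condition holds trivially. *)
Lemma free_tvs_submod (S : {pred V}) : GRing.submod_closed S ->
  (forall x, i x \in S) -> forall v, v \in S.
Proof.
move=> SC iS; apply: (nbhs0_submod SC).
have [_ SD] := SC; apply: free_tvs_disk_nbhs0.
- exact: submod_disk.
- by move=> x; apply/asboolP; exists 1 => //=; rewrite scale1r.
- move=> x e _; apply: nearW => y.
  have Sxy : i y - i x \in S by rewrite addrC -scaleN1r SD.
  by rewrite /= -[_ *: _]addr0 SD//; exact: SC.1.
Qed.

Lemma free_tvs_absorbed (A : set V) : disk A ->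
  (forall x, i x \in absorbed A) -> forall v, v \in absorbed A.
Proof. move=> dA; apply: free_tvs_submod; exact: absorbed_submod. Qed.

End free_tvs.

(** * Barrels of a free topological vector space *)

Lemma discrete_continuous (X Y : topologicalType) (f : X -> Y) :
  discrete_space X -> continuous f.
Proof. by move=> dX; apply/continuousP => B _; exact: dX. Qed.

Lemma nbhs1_discrete (X : topologicalType) :
  (forall x : X, nbhs x [set x]) -> discrete_space X.
Proof.
move=> nX A; rewrite openE => x Ax; apply: filterS (nX x).
by move=> _ ->.
Qed.

Section bipolar.
Context {R : realType} {X : topologicalType} {V : topologicalLmodType R}.
Variable i : X -> V.

(** When V is free over X, the forms g are the extensions to V of the continuous
functions X -> [-1, 1]. *)
Definition bipolar : set V := [set v | forall g : V -> R^o,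
  linear g -> continuous g -> (forall x, `|g (i x)| <= 1) -> `|g v| <= 1].

Lemma bipolar_disk : disk bipolar.
Proof.
split=> [g lg _ _|a b v w ab Bv Bw g lg cg g1].
  by rewrite (linear_map0 lg) normr0.
rewrite lg (linear_mapZ lg); apply: le_trans (ler_normD _ _) (le_trans _ ab).
by rewrite !normrZ; apply: lerD; apply: ler_piMr => //; [exact: Bv|exact: Bw].
Qed.

Lemma bipolar_closed : closed bipolar.
Proof.
move=> v clv g lg cg g1.
have cB : closed [set u | `|g u| <= 1].
  apply: (@closed_comp _ _ (fun u => `|g u|) [set r : R | r <= 1]).
    by move=> u _; apply: continuous_comp; [exact: cg|exact: norm_continuous].
  exact: closed_le.
apply: cB; apply: closureS clv => u; exact.
Qed.

Lemma sub_bipolar x : bipolar (i x).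
Proof. by move=> g _ _. Qed.

End bipolar.

Section free_tvs_barrelled.
Context {R : realType} {X : topologicalType} {V : topologicalLmodType R}.
Context {i : X -> V} (freeV : is_free_tvs i).

Lemma bipolar_barrel : barrel (bipolar i).
Proof.
split.
- exact: bipolar_closed.
- exact/disk_absolutely_convex/bipolar_disk.
- move=> v; apply: disk_absorbed; first exact: bipolar_disk.
  apply: (free_tvs_absorbed freeV); first exact: bipolar_disk.
  move=> x; apply/asboolP; exists 1 => //; rewrite scale1r.
  exact: sub_bipolar.
Qed.

(** Points of i(X) that differ by an element of the bipolar cannot be told
apart by more than 1 by a function X -> [-1, 1], so a neighborhood of x on which
this happens is reduced to x. *)
Lemma free_tvs_barrelled_discrete :
  tychonoff_space X -> barrelled V -> discrete_space X.
Proof.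
move=> [crX hX] /(_ _ bipolar_barrel) nB; apply: nbhs1_discrete => x.
have [_ ci extend] := freeV.
have : \forall y \near x, bipolar i (i y - i x).
  have ciB : continuous (fun y => i y - i x).
    by move=> y; apply: tvs_cvgD; [exact: ci|exact: cvg_cst].
  by apply: ciB; rewrite subrr.
apply: filterS => y Byx; apply: contrapT => /= yx.
have /(@uniform_separatorP _ R)[f [cf f01 fy fx]] :
    uniform_separator [set y] [set x].
  apply: crX => //; exact/accessible_closed_set1/hausdorff_accessible.
have {fy}fy : f y = 0 by apply: fy; exists y.
have {fx}fx : f x = 1 by apply: fx; exists x.
(* rescaling to [-1, 1] makes the gap h x - h y equal to 2 > 1 *)
pose h z : R^o := 2 * f z - 1.
have ch : continuous h.
  move=> z; apply: cvgB; last exact: cvg_cst.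
  by apply: cvgM; [exact: cvg_cst|exact: cf].
have [g [[lg cg hg] _]] := extend R^o h (@norm_hausdorff _ _) ch.
have ghE z : g (i z) = h z by rewrite hg.
have := Byx g lg cg; rewrite -scaleN1r addrC lg !ghE /h fx fy.
have h1 z : `|h z| <= 1.
  have /andP[f0 f1] : 0 <= f z <= 1.
    by have := f01 (f z) (ex_intro2 _ _ z I erefl); rewrite /= in_itv.
  rewrite /h ler_norml; lra.
have -> : -1 *: (2 * 1 - 1 : R^o) + (2 * 0 - 1) = -2 :> R.
  by rewrite /GRing.scale/=; ring.
have g1 z : `|g (i z)| <= 1 by rewrite ghE.
by move=> /(_ g1); rewrite normrN gtr0_norm//; lra.
Qed.

Lemma free_tvs_discrete_disk_nbhs0 (A : set V) : discrete_space X -> disk A ->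
  (forall x, i x \in absorbed A) -> nbhs 0 A.
Proof.
move=> dX dA iA; apply: (free_tvs_disk_nbhs0 freeV) => // x e _.
apply: (@filterS _ _ _ [set x]).
  by move=> _ ->; rewrite /= subrr scaler0; case: dA.
exact: open_nbhs_nbhs.
Qed.

Lemma free_tvs_discrete_barrelled : discrete_space X -> barrelled V.
Proof.
move=> dX A [_ acA absA]; apply: free_tvs_discrete_disk_nbhs0 => //.
  apply: absolutely_convex_disk => //; have [r r0 Ar] := absA 0.
  by rewrite -(scaler0 _ (0 : R)); apply: Ar; rewrite normr0 ltW.
move=> x; apply/asboolP; have [r r0 Ar] := absA (i x).
by exists r => //; apply: Ar; rewrite gtr0_norm.
Qed.

End free_tvs_barrelled.

(** * Exhaustions by closed proper subspaces *)

Section exhaustion.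
Context {R : realType} {E : topologicalLmodType R}.

Definition proper_exhaustion (F : nat -> {pred E}) :=
  [/\ forall n, GRing.submod_closed (F n) /\ closed [set v | v \in F n],
      {homo F : m n / (m <= n)%N >-> {subset m <= n}},
      forall v, exists n, v \in F n &
      forall n, exists v, v \notin F n].

Variable F : nat -> {pred E}.
Hypothesis FP : proper_exhaustion F.

Lemma proper_exhaustion_not_baire_like : ~ baire_like E.
Proof.
move=> bE; have [FC Fmono Fcover Fproper] := FP.
have [| | |n nF] := bE (fun n => [set v | v \in F n]).
- by move=> m n mn v; exact: Fmono.
- move=> n; split; last exact: (FC n).2.
  exact/disk_absolutely_convex/submod_disk/(FC n).1.
- by apply/seteqP; split => // v _; have [n Fv] := Fcover v; exists n.
have [v /negP[]] := Fproper n; exact: (nbhs0_submod (FC n).1).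
Qed.

Lemma proper_exhaustion_not_baire : ~ baire_space E.
Proof.
move=> bE; have [FC Fmono Fcover Fproper] := FP.
have denseF : dense (\bigcap_n ~` [set v | v \in F n]); last first.
  have [v [_ Fv]] := denseF setT (ex_intro _ 0 I) openT.
  by have [n Fnv] := Fcover v; exact: (Fv n I).
apply: bE => n; split; first by rewrite openC; exact: (FC n).2.
move=> O [w Ow] oO; apply: contrapT => OF.
have {}OF : O `<=` [set v | v \in F n].
  by move=> v Ov; apply: contrapT => nFv; apply: OF; exists v.
(* a translate of O is a neighborhood of 0 contained in the subspace F n *)
have nO : \forall v \near (0 : E), O (w + v).
  have : continuous (fun v => w + v).
    by move=> v; apply: tvs_cvgD; [exact: cvg_cst|exact: cvg_id].
  by apply; rewrite addr0; exact: open_nbhs_nbhs.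
have [v /negP[]] := Fproper n; apply: (nbhs0_submod (FC n).1).
apply: filterS nO => u Owu /=; have [_ SD] := (FC n).1.
rewrite -(addKr w u) -scaleN1r; apply: SD; exact: OF.
Qed.

End exhaustion.

(** * Baire spaces *)

Section baire_finite.
Context {R : realType}.

Lemma baire_open_image (T U : topologicalType) (h : T -> U) :
  continuous h -> (forall O, open O -> open (h @` O)) -> range h = setT ->
  baire_space T -> baire_space U.
Proof.
move=> ch oh hsurj bT D oD O [u Ou] oO.
have preim_neq0 (B : set U) : B !=set0 -> (h @^-1` B) !=set0.
  move=> [b Bb]; have [t _ tb] : range h b by rewrite hsurj.
  by exists t; rewrite /= tb.
have [|||t [Ot Dt]] := bT (fun n => h @^-1` D n) _ (h @^-1` O).
- move=> n; split; first by apply: open_comp (oD n).1 => ? _; exact: ch.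
  move=> P [p Pp] oP.
  have hP0 : (h @` P) !=set0 by exists (h p), p.
  have [v [[t Pt <-] Dv]] := (oD n).2 _ hP0 (oh _ oP).
  by exists t.
- by apply: preim_neq0; exists u.
- by apply: open_comp oO => ? _; exact: ch.
by exists (h t).
Qed.

(* Joins the completeness and the norm of matrices, which Baire's theorem needs
   together. *)
HB.instance Definition _ m n := Complete.on 'M[R]_(m, n).

Lemma rV_baire n : baire_space 'rV[R]_n.
Proof. by move=> D oD; exact: Baire. Qed.

Definition lincomb {E : lmodType R} (s : seq E) (a : 'rV[R]_(size s)) : E :=
  \sum_(k < size s) a ord0 k *: s`_k.

Arguments lincomb {E} s a.

Lemma lincomb_linear (E : lmodType R) (s : seq E) : linear (lincomb s).
Proof.
move=> c a b; rewrite /lincomb scaler_sumr -big_split/=.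
by apply: eq_bigr => k _; rewrite !mxE scalerDl scalerA.
Qed.

Lemma lincomb_continuous (E : topologicalLmodType R) (s : seq E) :
  continuous (lincomb s).
Proof.
rewrite /lincomb => a; elim: (index_enum _) => [|k r ih].
  by (under eq_fun do rewrite big_nil); exact: cst_continuous.
under eq_fun do rewrite big_cons.
apply: tvs_cvgD ih; apply: tvs_cvgZ; last exact: cvg_cst.
exact: coord_continuous.
Qed.

End baire_finite.

Arguments lincomb {R E} s a.

(** * Free topological vector spaces over discrete spaces *)

Section free_tvs_discrete.
Context {R : realType} {X : topologicalType} {V : topologicalLmodType R}.
Context {i : X -> V} (freeV : is_free_tvs i) (dX : discrete_space X).

Lemma free_tvs_finite_baire_like : finite_set [set: X] -> baire_like V.
Proof.
move=> finX A Amono Aacc Acover.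
have inA v : exists n, A n v.
  by have [n _ An] : (\bigcup_n A n) v by [rewrite Acover]; exists n.
have [s sX] := (finite_seqP _).1 finX.
have [n [An0 An]] : exists n, A n 0 /\ forall x, x \in s -> A n (i x).
  elim: s {sX} => [|x s [n [An0 An]]].
    by have [n] := inA 0; exists n.
  have [m Amx] := inA (i x); exists (maxn m n); split.
    exact: Amono (leq_maxr m n) _ An0.
  move=> y; rewrite inE => /orP[/eqP ->|ys].
    exact: Amono (leq_maxl m n) _ Amx.
  exact: Amono (leq_maxr m n) _ (An _ ys).
exists n; apply: (free_tvs_discrete_disk_nbhs0 freeV dX).
  by apply: absolutely_convex_disk => //; exact: (Aacc n).1.
move=> x; apply/asboolP; exists 1 => //; rewrite scale1r; apply: An.
by have : [set: X] x by []; rewrite sX.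
Qed.

(** The coordinates g : V -> R^n are continuous and are a section of the linear
combination map, so translating g gives local continuous sections, which makes
that map open. *)
Lemma free_tvs_finite_baire : finite_set [set: X] -> baire_space V.
Proof.
move=> /(finite_seqP _)[s sX].
have xs x : x \in s by have : [set: X] x by []; rewrite sX.
pose t := map i s.
pose f x : 'rV[R]_(size t) := \row_k ((k : nat) == index x s)%:R.
have [hV _ extend] := freeV.
have [g [[lg cg fg] _]] := extend _ f (@norm_hausdorff _ _)
  (discrete_continuous dX).
have gK : lincomb t \o g = id.
  apply: (free_tvs_ext freeV) => //.
  - by move=> a u v /=; rewrite lg lincomb_linear.
  - move=> v; apply: continuous_comp; first exact: cg.
    exact: lincomb_continuous.
  - by move=> v; exact: cvg_id.
  - apply/funext => x /=; rewrite -[g (i x)]/((g \o i) x) -fg /lincomb.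
    have lt_x : (index x s < size t)%N by rewrite size_map index_mem.
    rewrite (bigD1 (Ordinal lt_x))//= big1 ?addr0.
      by rewrite mxE eqxx scale1r (nth_map x) ?nth_index ?index_mem.
    move=> k /eqP kx; rewrite mxE; case: eqP => [kE|]; last by rewrite scale0r.
    by case: kx; apply: val_inj.
have {}gK v : lincomb t (g v) = v by rewrite -[LHS]/((lincomb t \o g) v) gK.
apply: (@baire_open_image _ _ (lincomb t) _ _ _ (@rV_baire R (size t))).
- exact: lincomb_continuous.
- move=> O oO; rewrite openE => _ [a Oa <-].
  (* the continuous section of lincomb that passes through a *)
  pose q v := (a - g (lincomb t a)) + g v.
  have cq : continuous q by move=> v; apply: cvgD; [exact: cvg_cst|exact: cg].
  have qa : q (lincomb t a) = a by rewrite /q subrK.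
  have qK v : lincomb t (q v) = v.
    rewrite /q (linear_mapD (@lincomb_linear _ _ t)) gK.
    rewrite (linear_mapD (@lincomb_linear _ _ t)) -scaleN1r.
    by rewrite (linear_mapZ (@lincomb_linear _ _ t)) gK scaleN1r subrr add0r.
  have : \forall v \near lincomb t a, O (q v).
    by apply: cq; rewrite qa; exact: open_nbhs_nbhs.
  by apply: filterS => v Oqv; exists (q v).
- by apply/seteqP; split => // v _; exists (g v).
Qed.

(** The n-th subspace is defined by the vanishing of the coordinates at
p n, p (n + 1), and so on, for an injective sequence p of points of X. *)
Lemma free_tvs_infinite_exhaustion : infinite_set [set: X] ->
  exists F : nat -> {pred V}, proper_exhaustion F.
Proof.
move=> /infiniteP/card_leP[u].
pose p n := val (u (exist _ n (mem_set I))).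
have p_inj : injective p.
  by move=> m n /val_inj /inj => /(_ (mem_set I) (mem_set I)) [].
have [_ _ extend] := freeV.
have /choice[c cP] : forall k, exists g : V -> R^o,
    [/\ linear g, continuous g & forall x, g (i x) = (x == p k)%:R].
  move=> k; have [g [[lg cg fg] _]] := extend R^o
    (fun x => (x == p k)%:R) (@norm_hausdorff _ _) (discrete_continuous dX).
  by exists g; split => // x; rewrite -[LHS]/((g \o i) x) -fg.
pose F n : {pred V} := fun v => `[< forall k, (n <= k)%N -> c k v = 0 >].
have FC n : GRing.submod_closed (F n).
  split => [|a v w /asboolP Fv /asboolP Fw]; apply/asboolP => k nk;
    have [lc _ _] := cP k; first exact: linear_map0.
  by rewrite lc Fv// Fw// scaler0 addr0.
exists F; split => [n|m n mn v /asboolP Fv|v|n].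
- split => //.
  have -> : [set v | v \in F n] =
      \bigcap_(k in [set k | (n <= k)%N]) (c k @^-1` [set 0]).
    by apply/seteqP; split=> [v /asboolP//|v Fv]; exact/asboolP.
  apply: closed_bigI => k _; have [_ ck _] := cP k.
  by apply: (continuous_closedP _).1.
- by apply/asboolP => k nk; apply: Fv; exact: leq_trans nk.
- pose S : {pred V} := fun v => `[< exists n, v \in F n >].
  suff /asboolP : v \in S by [].
  apply: (free_tvs_submod freeV) => [|x].
    split; first by apply/asboolP; exists 0%N; exact: (FC 0%N).1.
    move=> a w z /asboolP[m /asboolP Fw] /asboolP[n /asboolP Fz].
    apply/asboolP; exists (maxn m n); apply: (FC _).2; apply/asboolP => k;
      rewrite geq_max => /andP[mk nk]; [exact: Fw|exact: Fz].
  apply/asboolP; have [[m pm]|px] := pselect (exists m, x = p m).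
    exists m.+1; apply/asboolP => k mk; have [_ _ ->] := cP k.
    by rewrite pm; case: eqP => // /p_inj mkE; rewrite mkE ltnn in mk.
  exists 0%N; apply/asboolP => k _; have [_ _ ->] := cP k.
  by case: eqP => // xp; case: px; exists k.
- exists (i (p n)); apply/asboolP => /(_ n (leqnn n)).
  by have [_ _ ->] := cP n; rewrite eqxx => /eqP; rewrite oner_eq0.
Qed.

End free_tvs_discrete.

Theorem theorem5p2 (R : realType) (X : topologicalType)
    (V : topologicalLmodType R) (i : X -> V)
    (tychonoffX : tychonoff_space X) (freeV : is_free_tvs i) :
  [/\ barrelled V <-> discrete_space X,
      discrete_space X -> (baire_like V <-> finite_set [set: X]) &
      discrete_space X -> (baire_space V <-> finite_set [set: X])].
Proof.
split=> [|dX|dX].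
- split; first exact: (free_tvs_barrelled_discrete freeV).
  exact: (free_tvs_discrete_barrelled freeV).
- split; last exact: (free_tvs_finite_baire_like freeV).
  move=> bV; apply: contrapT => /(free_tvs_infinite_exhaustion freeV dX)[F FP].
  exact: (proper_exhaustion_not_baire_like FP).
- split; last exact: (free_tvs_finite_baire freeV).
  move=> bV; apply: contrapT => /(free_tvs_infinite_exhaustion freeV dX)[F FP].
  exact: (proper_exhaustion_not_baire FP).
Qed.
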